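(* Consider a general multivariate Tweedie common shock model (as defined in the context) with cell observations $$X_{ij}^{(n)} = \alpha_{ij}^{(n)} W_{\pi(i,j)} + \beta_{ij}^{(n)} W_{\pi(i,j)}^{(n)} + Z_{ij}^{(n)},\qquad \alpha_{ij}^{(n)}=\frac{\mu_{ij}^{(n)}}{\mu_{\pi(i,j)}}\frac{v_{ij}^{(n)}}{v_{\pi(i,j)}},\qquad \beta_{ij}^{(n)}=\frac{\mu_{ij}^{(n)}}{\mu_{\pi(i,j)}^{(n)}}\frac{v_{ij}^{(n)}}{v_{\pi(i,j)}^{(n)}} .$$ The model is auto-balanced if and only if there exist, for each $n$, quantities $C^{(n)},K^{(n)}>0$ depending only on $n$ such that the following two conditions hold for all cells $(i,j)$ and all $n$: (a) $v_{ij}^{(n)} = C^{(n)} v_{\pi(i,j)}$; and (b) $v_{ij}^{(n)} = K^{(n)} v_{\pi(i,j)}^{(n)}$. In this auto-balanced case, for all $i,j,n$, $$E\left[X_{ij}^{(n)}\right]=\kappa^{(n)}\mu_{ij}^{(n)},\qquad Var\left[X_{ij}^{(n)}\right]=\kappa^{(n)}\left(\sigma_{ij}^{(n)}\right)^2,\qquad CoV^2\left[X_{ij}^{(n)}\right]=\left(\kappa^{(n)}\right)^{-1}v_{ij}^{(n)},$$ where $\kappa^{(n)}=K^{(n)}+C^{(n)}+1$, which does not depend on the Tweedie power parameter $p$.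
   Context: Tweedie family. Let $p\in(-\infty,0]\cup[1,\infty)$, and for $p\ne1$ put $\alpha=(2-p)/(1-p)$. Let $\Theta_p=(0,\infty)$ for $p<0$, $\Theta_0=\mathbb{R}\setminus\{0\}$, $\Theta_1=\mathbb{R}$, $\Theta_p=(-\infty,0)$ for $p>1$. For $\theta\in\Theta_p$ let $b_p(\theta)=\frac{1}{2-p}[(1-p)\theta]^{(2-p)/(1-p)}$ if $p\neq1,2$; $b_1(\theta)=e^\theta$; $b_2(\theta)=-\ln(-\theta)$. For $\theta\in\Theta_p$, $\lambda>0$, $X\sim Tw_p^*(\theta,\lambda)$ means that $X$ has cumulant generating function $\log E[e^{tX}]=\lambda[b_p(\theta+t)-b_p(\theta)]$ for $t$ in a neighbourhood of $0$ (this determines the distribution). $CoV[X]$ denotes the coefficient of variation, so $CoV^2[X]=Var[X]/E[X]^2$. Arrays. There are $N$ claim arrays $\mathcal{A}^{(n)}=\{X_{ij}^{(n)}\}$, $n=1,\dots,N$, all congruent: the cells $(i,j)$ range over the same nonempty set of index pairs in $\{1,\dots,I\}\times\{1,\dots,J\}$ for every $n$. A fixed partition of this set of cells (the same for every array) is given, and $\pi(i,j)$ denotes the (label of the) partition subset containing cell $(i,j)$. General multivariate Tweedie common shock model. All variates $W_{\pi}$ (umbrella common shocks, one per partition subset), $W_{\pi}^{(n)}$ (array-specific common shocks, one per partition subset and array) and $Z_{ij}^{(n)}$ (idiosyncratic components, one per cell and array) are stochastically independent, with $W_{\pi(i,j)}\sim Tw_p^*(\theta_{\pi(i,j)},\lambda_{\pi(i,j)})$,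 $W_{\pi(i,j)}^{(n)}\sim Tw_p^*(\theta_{\pi(i,j)}^{(n)},\lambda_{\pi(i,j)}^{(n)})$, $Z_{ij}^{(n)}\sim Tw_p^*(\theta_{ij}^{(n)},\lambda_{ij}^{(n)})$ for a common $p$, where in the case $p=1$ it is required that $\theta_{\pi(i,j)}=\theta_{\pi(i,j)}^{(n)}=\theta_{ij}^{(n)}$. The mixture coefficients $\alpha_{ij}^{(n)},\beta_{ij}^{(n)}\ge0$ are those displayed in the claim (equivalently $\alpha_{ij}^{(n)}=\theta_{\pi(i,j)}/\theta_{ij}^{(n)}$, $\beta_{ij}^{(n)}=\theta_{\pi(i,j)}^{(n)}/\theta_{ij}^{(n)}$ for $p\neq1$, and $\alpha_{ij}^{(n)}=\beta_{ij}^{(n)}=1$ for $p=1$). Notation. $\mu_{\pi(i,j)},v_{\pi(i,j)}$ are the mean and squared CoV of $W_{\pi(i,j)}$; $\mu_{\pi(i,j)}^{(n)},v_{\pi(i,j)}^{(n)}$ those of $W_{\pi(i,j)}^{(n)}$; $\mu_{ij}^{(n)},v_{ij}^{(n)}$ those of $Z_{ij}^{(n)}$; and $(\sigma_{ij}^{(n)})^2=Var[Z_{ij}^{(n)}]=(\mu_{ij}^{(n)})^2v_{ij}^{(n)}$. Auto-balance. The model is auto-balanced if, for each $n$, the proportionate contribution of each shock and idiosyncratic component to cell expectation, i.e. each of $E[\alpha_{ij}^{(n)}W_{\pi(i,j)}]/E[X_{ij}^{(n)}]$, $E[\beta_{ij}^{(n)}W_{\pi(i,j)}^{(n)}]/E[X_{ij}^{(n)}]$,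 $E[Z_{ij}^{(n)}]/E[X_{ij}^{(n)}]$, is constant over all cells $(i,j)$. *)

(* Defs.v *)
From mathcomp Require Import all_boot all_order all_algebra.
From mathcomp Require Import all_classical all_reals all_analysis.

Set Implicit Arguments.
Unset Strict Implicit.
Unset Printing Implicit Defensive.

Import Order.TTheory GRing.Theory Num.Theory.
Import numFieldNormedType.Exports.

Local Open Scope classical_set_scope.
Local Open Scope ring_scope.

Section tweedie_family.
Context {R : realType}.
Implicit Types p theta lambda : R.

Definition tweedie_power p : Prop := p <= 0 \/ 1 <= p.

(* The value set0 is for 0 < p < 1, which is not a Tweedie power. *)
Definition tweedie_domain p : set R :=
  if p < 0 then [set theta | 0 < theta]
  else if p == 0 then [set theta | theta != 0]
  else if p == 1 then setT
  else if 1 < p then [set theta | theta < 0]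
  else set0.

(* For p = 0 the exponent (2 - p) / (1 - p) is 2 and theta may be negative,
   where powR is not the square; the integer power is used instead. In the last
   branch (1 - p) * theta > 0 on the domain. *)
Definition tweedie_b p theta : R :=
  if p == 1 then expR theta
  else if p == 2 then - ln (- theta)
  else if p == 0 then theta ^+ 2 / 2
  else (2 - p)^-1 * ((1 - p) * theta) `^ ((2 - p) / (1 - p)).

Context d (T : measurableType d) (P : probability T R).

Definition cumulant_gen_fun (X : T -> R) (t : R) : \bar R := lne ('M_P X t).

Definition tweedie_law p theta lambda (X : {RV P >-> R}) : Prop :=
  [/\ tweedie_domain p theta, 0 < lambda &
      \forall t \near (0 : R), cumulant_gen_fun X t =
        (lambda * (tweedie_b p (theta + t) - tweedie_b p theta))%:E].

End tweedie_family.

Section random_variables.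
Context {R : realType} d (T : measurableType d) (P : probability T R).

(* Real-valued moments; they are meaningful only if the extended-real
   expectation and variance are finite, because fine sends infinities to 0. *)
Definition mean (X : T -> R) : R := fine 'E_P[X]%E.
Definition var (X : T -> R) : R := fine ('V_P[X])%E.
Definition CoV2 (X : T -> R) : R := var X / mean X ^+ 2.

Definition mutually_independent (I : finType) (A : pred I)
    (X : I -> {RV P >-> R}) : Prop :=
  forall S : {set I}, {subset S <= A} ->
  forall B : I -> set R, (forall i, i \in S -> measurable (B i)) ->
    P (\bigcap_(i in [set` S]) (X i @^-1` B i)) =
    (\prod_(i in S) P (X i @^-1` B i))%E.

End random_variables.

Section common_shock_model.
Context {R : realType} d (T : measurableType d) (P : probability T R).
Variables N nI nJ : nat.

Definition cell := ('I_nI * 'I_nJ)%type.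

(* Labels of the variates: a partition subset labels an umbrella shock, an array
   and a partition subset label an array-specific shock, an array and a cell
   label an idiosyncratic component. *)
Definition source := ({set cell} + 'I_N * {set cell} + 'I_N * cell)%type.
Definition umbrella (b : {set cell}) : source := inl (inl b).
Definition array_shock (n : 'I_N) (b : {set cell}) : source := inl (inr (n, b)).
Definition idiosyncratic (n : 'I_N) (c : cell) : source := inr (n, c).

(* The values of variate, theta and lambda at labels that do not satisfy
   is_source below are irrelevant. *)
Record shock_arrays := ShockArrays {
  cells : {set cell} ;
  blocks : {set {set cell}} ;
  variate : source -> {RV P >-> R} ;
  theta : source -> R ;
  lambda : source -> R }.

Variable M : shock_arrays.

Definition is_source : pred source := fun s =>
  match s with
  | inl (inl b) => b \in blocks M
  | inl (inr (_, b)) => b \in blocks M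
  | inr (_, c) => c \in cells M
  end.

Definition block_of (c : cell) : {set cell} := finset.pblock (blocks M) c.

Definition W (c : cell) : {RV P >-> R} := variate M (umbrella (block_of c)).
Definition Wn (n : 'I_N) (c : cell) : {RV P >-> R} :=
  variate M (array_shock n (block_of c)).
Definition Z (n : 'I_N) (c : cell) : {RV P >-> R} :=
  variate M (idiosyncratic n c).

Definition alpha (n : 'I_N) (c : cell) : R :=
  mean P (Z n c) / mean P (W c) * (CoV2 P (Z n c) / CoV2 P (W c)).
Definition beta (n : 'I_N) (c : cell) : R :=
  mean P (Z n c) / mean P (Wn n c) * (CoV2 P (Z n c) / CoV2 P (Wn n c)).

Definition observation (n : 'I_N) (c : cell) : T -> R := fun w =>
  alpha n c * W c w + beta n c * Wn n c w + Z n c w.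

Record tweedie_common_shock (p : R) : Prop := TweedieCommonShock {
  cs_power : tweedie_power p ;
  cs_cells : exists c, c \in cells M ;
  cs_partition : finset.partition (blocks M) (cells M) ;
  cs_independent : mutually_independent is_source (variate M) ;
  cs_law : forall s, is_source s ->
    tweedie_law p (theta M s) (lambda M s) (variate M s) ;
  cs_poisson : p = 1 -> forall n c, c \in cells M ->
    theta M (umbrella (block_of c)) = theta M (array_shock n (block_of c)) /\
    theta M (array_shock n (block_of c)) = theta M (idiosyncratic n c) ;
  cs_coef_ge0 : forall n c, c \in cells M ->
    0 <= alpha n c /\ 0 <= beta n c }.

Definition auto_balanced : Prop :=
  forall n c c', c \in cells M -> c' \in cells M ->
  let share (Y : cell -> T -> R) x := mean P (Y x) / mean P (observation n x) in
  [/\ share (fun x w => alpha n x * W x w) c =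
      share (fun x w => alpha n x * W x w) c',
      share (fun x w => beta n x * Wn n x w) c =
      share (fun x w => beta n x * Wn n x w) c' &
      share (fun x => Z n x) c = share (fun x => Z n x) c'].

Definition balance_constants (C K : 'I_N -> R) : Prop :=
  forall n, [/\ 0 < C n, 0 < K n &
    forall c, c \in cells M ->
      CoV2 P (Z n c) = C n * CoV2 P (W c) /\
      CoV2 P (Z n c) = K n * CoV2 P (Wn n c)].

End common_shock_model.

Definition kappa {R : realType} (C K : R) : R := K + C + 1.

(* Main.v *)
(** A variate with cumulant generating function [k] near 0 has exponential
    moments, hence a finite second moment. By [1 + y <= expR y], [k t - t * m] is
    nonnegative ([m] the mean) and vanishes at 0, so [m = k'(0)], which is
    [lambda * b_p'(theta)] and nonzero; a zero variance would make [k] linear near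
    0, against the injectivity of [b_p']. Hence all means and squared CoVs in the
    model are nonzero. The two mixture coefficients are such that the shocks
    contribute [r * E Z] and [s * E Z] to the cell expectation, with
    [r = v_Z / v_W] and [s = v_Z / v_Wn], and, by independence, [r * Var Z] and
    [s * Var Z] to the cell variance. The shares are [r / k], [s / k] and [1 / k]
    with [k = r + s + 1], and they are constant exactly when [r] and [s] are. *)

Require Import Defs.
From HB Require Import structures.
From mathcomp Require Import all_boot all_order all_algebra.
From mathcomp Require Import all_classical all_reals all_analysis.
From mathcomp Require Import measurable_realfun ring lra.

Set Implicit Arguments.
Unset Strict Implicit.
Unset Printing Implicit Defensive.

Import Order.TTheory GRing.Theory Num.Theory.
Import numFieldNormedType.Exports.

Local Open Scope classical_set_scope.
Local Open Scope ring_scope.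

(** * The cumulant function [tweedie_b] and its derivative *)

Section tweedie_cumulant.
Context {R : realType}.
Implicit Types p theta : R.

(** Derivative of [tweedie_b] on the domain. The case [p = 0] is separate because [theta] may be
    negative there, where [powR] with exponent 1 is not the identity. *)
Definition tweedie_db p theta : R :=
  if p == 1 then expR theta
  else if p == 2 then - theta^-1
  else if p == 0 then theta
  else ((1 - p) * theta) `^ (1 - p)^-1.

(** Openness of the domain: [theta + t] stays inside for small [t], so the cumulant generating
    function can be differentiated near 0 and not only at 0. *)
Lemma tweedie_domain_near p theta : tweedie_domain p theta ->
  \forall t \near theta, tweedie_domain p t.
Proof.
rewrite /tweedie_domain; case: ifPn => _; first exact: lt_nbhsr.
case: ifPn => _.
  by move=> t0; apply: open_nbhs_nbhs; split => //; exact: open_neq.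
case: ifPn => _; first by move=> _; exact: filterT.
by case: ifPn => _ //; exact: lt_nbhsl.
Qed.

(** [1 - p] and [theta] are both positive for [p < 0] and both negative for [p > 1]. *)
Lemma tweedie_domain_arg_gt0 p theta : p != 0 -> p != 1 ->
  tweedie_domain p theta -> 0 < (1 - p) * theta.
Proof.
rewrite /tweedie_domain => /negPf -> /negPf ->.
by case: ltP => [p0 /= t0|_]; [nra|case: ltP => //= p1 t0; nra].
Qed.

Lemma tweedie_domain2_lt0 theta : tweedie_domain 2 theta -> theta < 0.
Proof.
rewrite /tweedie_domain; case: ltP => [|_]; first by lra.
case: eqP => [|_]; first by lra.
case: eqP => [|_]; first by lra.
by case: ltP => [//|]; lra.
Qed.

Lemma is_derive_tweedie_b p theta : tweedie_domain p theta ->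
  is_derive theta 1 (tweedie_b p) (tweedie_db p theta).
Proof.
move=> D; rewrite /tweedie_b /tweedie_db.
have [p1|p1] := eqVneq p 1; first exact: is_derive_expR.
have [p2|p2] := eqVneq p 2.
  have t0 : theta < 0 by apply: tweedie_domain2_lt0; rewrite -p2.
  have nt0 : 0 < - theta by rewrite oppr_gt0.
  apply: is_derive_eq (@is_deriveN R R R (@ln R \o -%R) theta 1 _
    (is_derive1_comp (is_derive1_ln nt0) (is_deriveNid theta 1))) _.
  by rewrite /GRing.scale/=; field; rewrite lt_eqF.
have [p0|p0] := eqVneq p 0.
  have -> : (fun x => x ^+ 2 / 2) = (2^-1 : R) *: (id ^+ 2 : R -> R).
    by apply/funext => x /=; rewrite /GRing.scale /= /GRing.exp/= mulrC.
  by apply: is_derive_eq; rewrite /GRing.scale/=; field.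
have a0 := tweedie_domain_arg_gt0 p0 p1 D.
set e : R := (2 - p) / (1 - p).
have p1' : 1 - p != 0 by rewrite subr_eq0 eq_sym.
have p2' : 2 - p != 0 by rewrite subr_eq0 eq_sym.
have d0 : is_derive theta 1 (fun x : R => (1 - p) * x) (1 - p).
  apply: is_derive_eq (is_deriveZ (1 - p) (is_derive_id theta 1)) _.
  by rewrite /GRing.scale/= mulr1.
(* In the chain rule the constants [(2 - p)^-1], [e] and [1 - p] multiply to 1. *)
have := is_deriveZ (2 - p)^-1
  (@is_derive1_comp R ((@powR R) ^~ e) _ theta _ _ (is_derive1_powR e a0) d0).
move=> h; apply: is_derive_eq h _.
rewrite /GRing.scale/=.
have -> : e - 1 = (1 - p)^-1 by rewrite /e; field.
by rewrite /e; field; rewrite p1'.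
Qed.

(** Makes the mean nonzero. For [p = 0] it rests on the exclusion of 0 from the domain. *)
Lemma tweedie_db_neq0 p theta : tweedie_domain p theta ->
  tweedie_db p theta != 0.
Proof.
move=> D; rewrite /tweedie_db.
have [p1|p1] := eqVneq p 1; first by rewrite gt_eqF// expR_gt0.
have [p2|p2] := eqVneq p 2.
  by rewrite oppr_eq0 invr_eq0 lt_eqF// tweedie_domain2_lt0// -p2.
have [p0|p0] := eqVneq p 0; first by move: D; rewrite p0 /tweedie_domain ltxx eqxx.
by rewrite gt_eqF// powR_gt0// tweedie_domain_arg_gt0.
Qed.

Lemma tweedie_db_inj p theta1 theta2 :
  tweedie_domain p theta1 -> tweedie_domain p theta2 ->
  tweedie_db p theta1 = tweedie_db p theta2 -> theta1 = theta2.
Proof.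
move=> D1 D2; rewrite /tweedie_db.
have [p1|p1] := eqVneq p 1; first exact: expR_inj.
have [p2|p2] := eqVneq p 2; first by move=> /oppr_inj /invr_inj.
have [p0|p0] := eqVneq p 0; first by [].
have a1 := tweedie_domain_arg_gt0 p0 p1 D1.
have a2 := tweedie_domain_arg_gt0 p0 p1 D2.
have p1' : 1 - p != 0 by rewrite subr_eq0 eq_sym.
(* The power [1 - p] undoes the exponent [(1 - p)^-1] on positive bases. *)
move=> /(congr1 ((@powR R) ^~ (1 - p))).
by rewrite /= -!powRrM mulVf// !powRr1 ?ltW// => /(mulfI p1').
Qed.

End tweedie_cumulant.

(** * Consequences of finite exponential moments *)

Section exponential_moments.
Context {R : realType} d (T : measurableType d) (P : probability T R).
Variable X : {RV P >-> R}.

Let mexp (t : R) : measurable_fun setT (EFin \o (expR \o t \o* X) : T -> \bar R).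
Proof.
apply/measurable_EFinP; apply: measurableT_comp => //.
Qed.

Lemma mgf_integrable (t : R) : 'M_P X t \is a fin_num ->
  P.-integrable setT (EFin \o (expR \o t \o* X) : T -> \bar R).
Proof.
move=> fM; apply/integrableP; split => //.
under eq_integral do rewrite /= ger0_norm ?expR_ge0//.
move: fM; rewrite /mmt_gen_fun unlock ge0_fin_numE//.
by apply: integral_ge0 => x _; rewrite lee_fin expR_ge0.
Qed.

(* [(x * t) ^+ 2 <= 2 * expR `|x * t|] makes the square integrable. *)
Lemma mgf_Lfun2 (t : R) : t != 0 -> 'M_P X t \is a fin_num ->
  'M_P X (- t) \is a fin_num -> (X : T -> R) \in Lfun P 2%:E.
Proof.
move=> t0 /mgf_integrable i1 /mgf_integrable i2.
have mX2 : measurable_fun setT (EFin \o (fun w => X w ^+ 2) : T -> \bar R).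
  by apply/measurable_EFinP; exact: measurable_funX.
have iX2 : P.-integrable setT (EFin \o (fun w => X w ^+ 2)).
  have t20 : 0 < t ^+ 2 by rewrite exprn_even_gt0.
  have := integrableZl measurableT (2 / t ^+ 2) (integrableD measurableT i1 i2).
  apply: le_integrable => // x _ /=.
  rewrite lee_fin ger0_norm; last by rewrite sqr_ge0.
  rewrite (le_trans _ (ler_norm _))// mulrAC ler_pdivlMr//.
  rewrite -exprMn mulrN.
  have h (y : R) : 0 <= y -> y ^+ 2 <= 2 * expR y.
    by move=> y0; have := expR_ge1Dxn 1 y0; rewrite (_ : 2`! = 2)%N//; lra.
  have eN := expR_ge0 (- (X x * t)); have e0 := expR_ge0 (X x * t).
  have [y0|y0] := leP 0 (X x * t); first by have := h _ y0; lra.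
  by have := h (- (X x * t)); rewrite sqrrN; lra.
rewrite inE; apply/andP; split; rewrite inE/=; first exact: measurable_funPT.
(* The norm is finite as soon as its square is, and that square is the integral of [X ^+ 2]. *)
rewrite /finite_norm (@lty_poweRy _ _ 2)// powR_Lnorm//.
under eq_integral do rewrite /= powR_mulrn// -normrX.
by have /integrableP[] := iX2.
Qed.

(** Jensen's inequality for the exponential, by comparison with a tangent line. *)
Lemma mean_le_cgf (t k : R) : (X : T -> R) \in Lfun P 1 ->
  'M_P X t = (expR k)%:E -> t * mean P X <= k.
Proof.
move=> X1 Mt; set m := mean P X.
have Em : 'E_P[X]%E = m%:E by rewrite fineK// expectation_fin_num.
(* [expR (t * m) \o* Y] is the tangent to [expR] at [t * m], evaluated at [t * X]; since [Y] has
   mean 1, its expectation is [expR (t * m)]. *)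
pose Y : T -> R := cst (1 - t * m) \+ t \o* X.
have tX1 : t \o* X \in Lfun P 1 by exact: Lfun_scale.
have Y1 : Y \in Lfun P 1 by rewrite rpredD// Lfun_cst.
have EY : 'E_P[expR (t * m) \o* Y]%E = (expR (t * m))%:E.
  rewrite expectationZl// expectationD ?Lfun_cst// expectation_cst.
  by rewrite expectationZl// Em -(EFinM t) -EFinD -EFinM subrK mulr1.
rewrite -ler_expR -lee_fin -EY -Mt /mmt_gen_fun unlock.
apply: le_integral => //.
- have Y1' : expR (t * m) \o* Y \in Lfun P 1 by exact: Lfun_scale.
  exact: ((Lfun1_integrable _ _).1 Y1').
- by apply: mgf_integrable; rewrite Mt.
move=> x _; rewrite lee_fin /Y /=.
have -> : X x * t = (X x * t - t * m) + t * m by ring.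
rewrite expRD ler_wpM2r ?expR_ge0//.
by have := expR_ge1Dx (X x * t - t * m); lra.
Qed.

(** A nonnegative function with zero integral vanishes almost everywhere; applied to the squared
    deviation, it makes [X] almost surely equal to its mean. *)
Lemma var0_mgf (t : R) : (X : T -> R) \in Lfun P 2%:E -> var P X = 0 ->
  'M_P X t = (expR (t * mean P X))%:E.
Proof.
move=> X2; rewrite /var => V0.
have {}V0 : ('V_P[X])%E = 0%E by rewrite -(fineK (variance_fin_num X2)) V0.
have mXm : measurable_fun setT (EFin \o (fun w => (X w - mean P X) ^+ 2) : T -> \bar R).
  by apply/measurable_EFinP; apply: measurable_funX; exact: measurable_funB.
have : ae_eq P setT (EFin \o (fun w => (X w - mean P X) ^+ 2)) (cst 0%E).
  apply/ae_eq_integral_abs => //; rewrite -V0 /variance unlock unlock.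
  by apply: eq_integral => x _ /=; rewrite ger0_norm ?sqr_ge0 // /mean unlock.
move=> aeX; rewrite /mmt_gen_fun -(expectation_cst P) unlock.
apply: ae_eq_integral => //.
- exact: mexp.
- exact/measurable_EFinP/measurable_cst.
move: aeX; apply: filterS => x /= /(_ I) /eqP; rewrite eqe sqrf_eq0 subr_eq0 => /eqP ->.
by rewrite mulrC.
Qed.

End exponential_moments.

(** * Expectation of a product of independent variates *)

Section independent_product.
Context {R : realType} d (T : measurableType d) (P : probability T R).
Variables X Y : {RV P >-> R}.
Hypothesis XY : forall A B : set R, measurable A -> measurable B ->
  P (X @^-1` A `&` Y @^-1` B) = (P (X @^-1` A) * P (Y @^-1` B))%E.

Let XYpair : T -> R * R := fun w => (X w, Y w).

Let mXYpair : measurable_fun setT XYpair.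
Proof. exact/measurable_fun_pair. Qed.

HB.instance Definition _ := isMeasurableFun.Build _ _ _ _ XYpair mXYpair.

(** The law of the pair is the product of the two laws, so Fubini's theorem splits the integral of
    [z.1 * z.2]. *)
Lemma independent_expectationM :
  (X : T -> R) \in Lfun P 1 -> (Y : T -> R) \in Lfun P 1 ->
  ((X : T -> R) \* Y) \in Lfun P 1 ->
  'E_P[(X : T -> R) \* Y]%E = ('E_P[X] * 'E_P[Y])%E.
Proof.
move=> X1 Y1 XY1.
pose f : R * R -> \bar R := fun z => (z.1 * z.2)%:E.
have mf : measurable_fun setT f.
  by apply/measurable_EFinP; exact: measurable_funM.
have fXY : P.-integrable setT (f \o XYpair) by exact/Lfun1_integrable.
(* By [XY] the two measures agree on measurable rectangles, which determine the product measure. *)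
have jointE A : measurable A ->
    (distribution P X \x distribution P Y)%E A = distribution P XYpair A.
  by apply: product_measure_unique => B C mB mC; rewrite -[RHS]XY.
have intf : (distribution P X \x distribution P Y)%E.-integrable setT f.
  have := @integrable_pushforward _ _ _ _ _ XYpair mXYpair P setT f mf fXY measurableT.
  move=> /integrableP[_ fin]; apply/integrableP; split => //.
  apply: le_lt_trans fin; rewrite le_eqVlt; apply/orP; left; apply/eqP.
  by apply: eq_measure_integral => A mA _; exact: jointE.
transitivity (\int[distribution P XYpair]_z f z)%E.
  by rewrite integral_distribution// unlock.
transitivity (\int[distribution P X \x distribution P Y]_z f z)%E.
  by apply: eq_measure_integral => A mA _; exact/esym/jointE.
rewrite -integral12_prod_meas1//.
have EXY x : (\int[distribution P Y]_y f (x, y) = x%:E * 'E_P[Y])%E.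
  rewrite integral_distribution//=.
  - rewrite unlock -integralZl//; exact: ((Lfun1_integrable _ _).1 Y1).
  - by apply/measurable_EFinP => /=; exact: measurable_funM.
  - exact: (integrableZl measurableT x ((Lfun1_integrable _ _).1 Y1)).
rewrite /fubini_F; under eq_integral do rewrite EXY.
(* The inner integral must be a real factor to be pulled out of the outer one. *)
have [r Er] : exists r, 'E_P[Y]%E = r%:E.
  by exists (fine 'E_P[Y]%E); rewrite fineK// expectation_fin_num.
rewrite Er integral_distribution//=.
- rewrite unlock -integralZr//; exact: ((Lfun1_integrable _ _).1 X1).
- by apply/measurable_EFinP; exact: measurable_funM.
- exact: (integrableZr measurableT r ((Lfun1_integrable _ _).1 X1)).
Qed.

End independent_product.

(** * Mean and variance of a Tweedie variate *)

Section tweedie_moments.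
Context {R : realType} d (T : measurableType d) (P : probability T R).
Variables (X : {RV P >-> R}) (p theta lambda : R).
Hypothesis lawX : tweedie_law p theta lambda X.

Let cgf (t : R) := lambda * (tweedie_b p (theta + t) - tweedie_b p theta).

(** A finite value of [lne] forces a finite positive argument, so the logarithm can be inverted. *)
Let mgf_near : \forall t \near (0 : R), 'M_P X t = (expR (cgf t))%:E.
Proof.
have [_ _] := lawX; apply: filterS => t.
rewrite /cumulant_gen_fun /cgf; case: ('M_P X t) => [r| |] //=.
by case: ifPn => //; rewrite -ltNge => r0 [<-]; rewrite lnK// posrE.
Qed.

Let cgf_derive : \forall t \near (0 : R),
  is_derive (t : R) 1 cgf (lambda * tweedie_db p (theta + t)).
Proof.
have [D _ _] := lawX.
have /nbhs0P := tweedie_domain_near D; apply: filterS => t /is_derive_tweedie_b db.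
have ds : is_derive (t : R) 1 (fun t => theta + t) 1.
  by apply: is_derive_eq (is_deriveD (is_derive_cst theta t 1) (is_derive_id t 1)) _;
    rewrite add0r.
have := is_deriveZ lambda
  (is_deriveB (@is_derive1_comp R _ _ t _ _ db ds) (is_derive_cst (tweedie_b p theta) t 1)).
by move=> h; apply: is_derive_eq h _; rewrite /GRing.scale/= subr0 mulr1.
Qed.

(** Both [e / 2] and its opposite lie in the neighbourhood where the moment generating function is
    finite. *)
Lemma tweedie_Lfun2 : (X : T -> R) \in Lfun P 2%:E.
Proof.
have [e /= e0 He] := mgf_near.
have h t : `|t| < e -> 'M_P X t \is a fin_num.
  by move=> te; rewrite He//= sub0r normrN.
apply: (@mgf_Lfun2 _ _ _ _ _ (e / 2)); first by rewrite gt_eqF// divr_gt0.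
- by apply: h; rewrite gtr0_norm ?divr_gt0//; lra.
- by apply: h; rewrite normrN gtr0_norm ?divr_gt0//; lra.
Qed.

(* [cgf t - t * mean P X] is minimal at [t = 0]. *)
Lemma tweedie_mean : mean P X = lambda * tweedie_db p theta.
Proof.
have X1 : (X : T -> R) \in Lfun P 1.
  by apply: Lfun_subset12 tweedie_Lfun2; exact: fin_num_measure.
have [e /= e0 He] : \forall t \near (0 : R), 'M_P X t = (expR (cgf t))%:E /\
    is_derive (t : R) 1 cgf (lambda * tweedie_db p (theta + t)).
  exact: filterI.
set m := mean P X.
have dg (t : R) : t \in `]- e, e[ -> is_derive (t : R) 1 (cgf - m *: id)
    (lambda * tweedie_db p (theta + t) - m).
  rewrite in_itv/= => te.
  have [|_ dt] := He t; first by rewrite /= sub0r normrN ltr_norml.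
  by apply: is_derive_eq (is_deriveB dt (is_deriveZ m (is_derive_id t 1))) _;
    rewrite /GRing.scale/= mulr1.
have gE s : (cgf - m *: id) s = cgf s - m * s by [].
have e0' : (0 : R) \in `]- e, e[ by rewrite in_itv/= oppr_lt0 e0.
have [_ g0] := dg _ e0'.
have : is_derive (0 : R) 1 (cgf - m *: id) 0.
  apply: (@derive1_at_min _ _ (- e) e) => //; first by lra.
    by move=> t te; have [] := dg t te.
  move=> t; rewrite in_itv/= => te.
  have [|Mt _] := He t; first by rewrite /= sub0r normrN ltr_norml.
  have := mean_le_cgf X1 Mt.
  have -> : (cgf - m *: id) 0 = 0 by rewrite gE /cgf addr0 subrr !mulr0 subrr.
  by rewrite gE -/m; lra.
move=> [_]; rewrite g0 addr0 => /eqP; rewrite subr_eq0 => /eqP ->//.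
Qed.

Lemma tweedie_mean_neq0 : mean P X != 0.
Proof.
have [D l0 _] := lawX.
by rewrite tweedie_mean mulf_neq0 ?tweedie_db_neq0 ?lt0r_neq0.
Qed.

(* A zero variance makes the cumulant generating function linear near 0,
   hence the derivative of [tweedie_b] locally constant. *)
Lemma tweedie_var_gt0 : 0 < var P X.
Proof.
have [D l0 _] := lawX.
rewrite lt_neqAle fine_ge0 ?variance_ge0// andbT eq_sym; apply/eqP => V0.
set m := mean P X.
have lin : \forall t \near (0 : R), cgf t = (m *: id) t.
  apply: filterS mgf_near => t; rewrite (var0_mgf _ tweedie_Lfun2 V0) => -[].
  by move=> /expR_inj <-; rewrite /GRing.scale/= mulrC.
have [t [t0 Dt dlt]] : exists t : R, [/\ t != 0, tweedie_domain p (theta + t) &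
    lambda * tweedie_db p (theta + t) = m].
  have : \forall t \near (0 : R), tweedie_domain p (theta + t) /\
      lambda * tweedie_db p (theta + t) = m.
    apply: filterI; first by have /nbhs0P := tweedie_domain_near D.
    (* The equality holds near every [t] close to 0, so the derivatives agree at such [t] as
       well. *)
    move: lin => /near_join; apply: filterS2 cgf_derive => t dt lt.
    have [_ <-] := near_eq_is_derive lt dt.
    by rewrite derive_val /GRing.scale/= mulr1.
  move=> [e /= e0 He]; exists (e / 2).
  have [|De dle] := He (e / 2).
    by rewrite /= sub0r normrN gtr0_norm ?divr_gt0//; lra.
  by split => //; rewrite gt_eqF// divr_gt0.
(* [tweedie_db] takes the same value at [theta + t] and [theta]; injectivity gives [t = 0], a
   contradiction. *)
move: dlt; rewrite /m tweedie_mean => /(mulfI (lt0r_neq0 l0)).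
move=> /(tweedie_db_inj Dt D) /eqP; rewrite -subr_eq0 addrAC subrr add0r.
exact/negP.
Qed.

Lemma tweedie_CoV2_gt0 : 0 < CoV2 P X.
Proof.
rewrite divr_gt0 ?tweedie_var_gt0//.
by rewrite exprn_even_gt0// tweedie_mean_neq0.
Qed.

End tweedie_moments.

Lemma mutually_independent_pair {R : realType} d (T : measurableType d)
    (P : probability T R) (I : finType) (A : pred I) (X : I -> {RV P >-> R})
    (i j : I) (B C : set R) :
  mutually_independent A X -> A i -> A j -> i != j ->
  measurable B -> measurable C ->
  P (X i @^-1` B `&` X j @^-1` C) = (P (X i @^-1` B) * P (X j @^-1` C))%E.
Proof.
move=> indep Ai Aj ij mB mC.
(* One family of sets on the pair of labels; [i != j] ensures that [D j] is [C]. *)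
pose D k := if k == i then B else C.
have ji : (j == i) = false by rewrite eq_sym (negPf ij).
have SA : {subset [set i; j]%SET <= A} by move=> k /set2P[] ->.
have /= := indep _ SA D.
rewrite big_setU1 ?inE//= big_set1 /D eqxx ji => <-; last first.
  by move=> k _; case: ifP.
congr (P _); apply/seteqP; split => [w [Bw Cw] k /= /set2P[] -> | w h].
- by rewrite eqxx.
- by rewrite ji.
- split; first by have := h i; rewrite /= eqxx; apply; exact: set21.
  by have := h j; rewrite /= ji; apply; exact: set22.
Qed.

(** * Moments and shares of a cell observation *)

Section common_shock_moments.
Context {R : realType} d (T : measurableType d) (P : probability T R).
Variables (N nI nJ : nat) (M : shock_arrays P N nI nJ) (p : R).
Hypothesis hM : tweedie_common_shock M p.

Lemma block_of_blocks c : c \in cells M -> block_of M c \in blocks M.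
Proof.
have /and3P[/eqP cov _ _] := cs_partition hM.
by rewrite -cov => /pblock_mem.
Qed.

Lemma source_Lfun2 s : is_source M s -> (variate M s : T -> R) \in Lfun P 2%:E.
Proof. by move=> /(cs_law hM)/tweedie_Lfun2. Qed.

Lemma source_Lfun1 s : is_source M s -> (variate M s : T -> R) \in Lfun P 1.
Proof.
by move=> /source_Lfun2; apply: Lfun_subset12; exact: fin_num_measure.
Qed.

Lemma source_mean_neq0 s : is_source M s -> mean P (variate M s) != 0.
Proof. by move=> /(cs_law hM)/tweedie_mean_neq0. Qed.

Lemma source_CoV2_gt0 s : is_source M s -> 0 < CoV2 P (variate M s).
Proof. by move=> /(cs_law hM)/tweedie_CoV2_gt0. Qed.

(** Integrability excludes the infinite values, which [fine] would send to 0. *)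
Lemma source_meanE s : is_source M s ->
  'E_P[variate M s]%E = (mean P (variate M s))%:E.
Proof. by move=> /source_Lfun1 h; rewrite fineK// expectation_fin_num. Qed.

Lemma source_varE s : is_source M s ->
  ('V_P[variate M s])%E = (mean P (variate M s) ^+ 2 * CoV2 P (variate M s))%:E.
Proof.
move=> hs; rewrite /CoV2 mulrC divfK ?sqrf_eq0 ?source_mean_neq0//.
by rewrite fineK// variance_fin_num// source_Lfun2.
Qed.

(** Distinct labels carry independent variates, for which the expectation of the product factors. *)
Lemma source_covariance s s' : is_source M s -> is_source M s' -> s != s' ->
  covariance P (variate M s) (variate M s') = 0%E.
Proof.
move=> hs hs' ss'.
have XY1 := Lfun2_mul_Lfun1 (source_Lfun2 hs) (source_Lfun2 hs').
rewrite covarianceE ?source_Lfun1// independent_expectationM ?source_Lfun1//.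
  by rewrite subee// fin_numM ?expectation_fin_num ?source_Lfun1.
by move=> A B mA mB; apply: mutually_independent_pair (cs_independent hM) _ _ _ _ _.
Qed.

Variables (n : 'I_N) (c : cell nI nJ).
Hypothesis cM : c \in cells M.

Let sW : is_source M (umbrella N (block_of M c)).
Proof. exact: block_of_blocks. Qed.

Let sWn : is_source M (array_shock n (block_of M c)).
Proof. exact: block_of_blocks. Qed.

Let sZ : is_source M (idiosyncratic n c).
Proof. exact: cM. Qed.

(** Under [balance_constants] this ratio and the next equal [C n] and [K n] in every cell. *)
Definition umbrella_ratio : R := CoV2 P (Z M n c) / CoV2 P (W M c).
Definition array_ratio : R := CoV2 P (Z M n c) / CoV2 P (Wn M n c).

Lemma umbrella_ratio_gt0 : 0 < umbrella_ratio.
Proof. by rewrite divr_gt0// source_CoV2_gt0. Qed.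

Lemma array_ratio_gt0 : 0 < array_ratio.
Proof. by rewrite divr_gt0// source_CoV2_gt0. Qed.

Lemma alpha_mean : alpha M n c * mean P (W M c) = umbrella_ratio * mean P (Z M n c).
Proof.
have := source_mean_neq0 sW; have := lt0r_neq0 (source_CoV2_gt0 sW).
by rewrite /alpha /umbrella_ratio -/(W M c) => ? ?; field; apply/andP.
Qed.

Lemma beta_mean : beta M n c * mean P (Wn M n c) = array_ratio * mean P (Z M n c).
Proof.
have := source_mean_neq0 sWn; have := lt0r_neq0 (source_CoV2_gt0 sWn).
by rewrite /beta /array_ratio -/(Wn M n c) => ? ?; field; apply/andP.
Qed.

Lemma mean_umbrella_part :
  mean P (fun w => alpha M n c * W M c w) = umbrella_ratio * mean P (Z M n c).
Proof.
have -> : (fun w => alpha M n c * W M c w) = alpha M n c \o* W M c.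
  by apply/funext => w /=; rewrite mulrC.
by rewrite /mean expectationZl ?source_Lfun1// source_meanE//= alpha_mean.
Qed.

Lemma mean_array_part :
  mean P (fun w => beta M n c * Wn M n c w) = array_ratio * mean P (Z M n c).
Proof.
have -> : (fun w => beta M n c * Wn M n c w) = beta M n c \o* Wn M n c.
  by apply/funext => w /=; rewrite mulrC.
by rewrite /mean expectationZl ?source_Lfun1// source_meanE//= beta_mean.
Qed.

Lemma observationE :
  observation M n c = (alpha M n c \o* W M c \+ beta M n c \o* Wn M n c) \+ Z M n c.
Proof. by apply/funext => w; rewrite /observation/= mulrC [_ * Wn _ _ _ _]mulrC. Qed.

Let ratio := kappa umbrella_ratio array_ratio.

Lemma expectation_observation :
  'E_P[observation M n c]%E = (ratio * mean P (Z M n c))%:E.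
Proof.
have W1 : alpha M n c \o* W M c \in Lfun P 1 by rewrite Lfun_scale// source_Lfun1.
have Wn1 : beta M n c \o* Wn M n c \in Lfun P 1 by rewrite Lfun_scale// source_Lfun1.
have Z1 : (Z M n c : T -> R) \in Lfun P 1 by rewrite source_Lfun1.
rewrite observationE !expectationD ?rpredD// !expectationZl ?source_Lfun1//.
rewrite !source_meanE// -(EFinM (alpha _ _ _)) alpha_mean.
rewrite -(EFinM (beta _ _ _)) beta_mean -!EFinD; congr EFin.
by rewrite /ratio /kappa; ring.
Qed.

(* [alpha ^+ 2 * Var W = (alpha * E W) ^+ 2 * CoV2 W = E Z ^+ 2 * CoV2 Z ^+ 2 / CoV2 W] *)
Lemma variance_observation :
  ('V_P[observation M n c])%E = (ratio * var P (Z M n c))%:E.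
Proof.
have W2 := source_Lfun2 sW; have Wn2 := source_Lfun2 sWn; have Z2 := source_Lfun2 sZ.
have aW2 : alpha M n c \o* W M c \in Lfun P 2%:E by rewrite Lfun_scale// ler1n.
have bWn2 : beta M n c \o* Wn M n c \in Lfun P 2%:E by rewrite Lfun_scale// ler1n.
have Pfin : P setT \is a fin_num by exact: fin_num_measure.
rewrite observationE varianceD//; last by rewrite rpredD// lee1n.
rewrite varianceD// covarianceDl// !varianceZ//.
rewrite !covarianceZl ?covarianceZr ?source_Lfun1//;
  [|exact: Lfun2_mul_Lfun1..|by rewrite Lfun_scale// source_Lfun1|exact: Lfun2_mul_Lfun1].
(* The three labels come from different constructors of [source], hence are distinct, and all cross
   terms vanish. *)
rewrite !source_covariance// !mule0 !adde0 !mule0 !adde0.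
rewrite !source_varE// -!EFinM -!EFinD; congr EFin.
rewrite [var _ _](_ : _ = mean P (Z M n c) ^+ 2 * CoV2 P (Z M n c)); last first.
  by rewrite /var source_varE.
have sq (x y v : R) : x ^+ 2 * (y ^+ 2 * v) = (x * y) ^+ 2 * v by ring.
rewrite 2!sq alpha_mean beta_mean /ratio /kappa.
rewrite /umbrella_ratio /array_ratio.
have := lt0r_neq0 (source_CoV2_gt0 sW); have := lt0r_neq0 (source_CoV2_gt0 sWn).
by rewrite -/(W M c) -/(Wn M n c) -/(Z M n c) => ? ?; field; apply/andP.
Qed.

Lemma CoV2_observation : CoV2 P (observation M n c) = ratio^-1 * CoV2 P (Z M n c).
Proof.
have r0 : 0 < ratio.
  by rewrite /ratio /kappa !addr_gt0 ?umbrella_ratio_gt0 ?array_ratio_gt0.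
have m0 : mean P (Z M n c) != 0 by exact: source_mean_neq0 sZ.
rewrite /CoV2 [var P (observation _ _ _)]/var variance_observation.
rewrite [mean P (observation _ _ _)]/mean expectation_observation/=.
by field; rewrite m0 gt_eqF.
Qed.

(** The mean of [Z] cancels, which leaves only the two ratios. *)
Lemma share_Z : mean P (Z M n c) / mean P (observation M n c) = ratio^-1.
Proof.
rewrite [mean P (observation _ _ _)]/mean expectation_observation/=.
by rewrite invfM mulrCA divff ?mulr1// source_mean_neq0.
Qed.

Lemma share_W : mean P (fun w => alpha M n c * W M c w) / mean P (observation M n c) =
  umbrella_ratio / ratio.
Proof. by rewrite mean_umbrella_part -mulrA share_Z. Qed.

Lemma share_Wn : mean P (fun w => beta M n c * Wn M n c w) / mean P (observation M n c) =
  array_ratio / ratio.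
Proof. by rewrite mean_array_part -mulrA share_Z. Qed.

Lemma kappa_ratio_neq0 : kappa umbrella_ratio array_ratio != 0.
Proof.
by rewrite gt_eqF// /kappa !addr_gt0 ?umbrella_ratio_gt0 ?array_ratio_gt0.
Qed.

End common_shock_moments.

Theorem proposition5p1 (R : realType) (d : measure_display)
    (T : measurableType d) (P : probability T R) (N nI nJ : nat)
    (M : shock_arrays P N nI nJ) (p : R) (hM : tweedie_common_shock M p) :
  (auto_balanced M <-> exists C K : 'I_N -> R, balance_constants M C K) /\
  (auto_balanced M ->
   forall C K : 'I_N -> R, balance_constants M C K ->
   forall (n : 'I_N) (c : cell nI nJ), c \in cells M ->
   [/\ 'E_P[observation M n c]%E = (kappa (C n) (K n) * mean P (Z M n c))%:E,
       ('V_P[observation M n c])%E = (kappa (C n) (K n) * var P (Z M n c))%:E &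
       CoV2 P (observation M n c) =
         (kappa (C n) (K n))^-1 * CoV2 P (Z M n c)]).
Proof.
(* Dividing conditions (a) and (b) by the positive squared CoVs shows that the model determines the
   constants. *)
have ratios C K n c : balance_constants M C K -> c \in cells M ->
    umbrella_ratio M n c = C n /\ array_ratio M n c = K n.
  move=> /(_ n)[_ _ CK] cM; have [eC eK] := CK c cM.
  split.
    rewrite /umbrella_ratio eC mulfK// lt0r_neq0//.
    by apply: (source_CoV2_gt0 hM); exact: (block_of_blocks hM).
  rewrite /array_ratio eK mulfK// lt0r_neq0//.
  by apply: (source_CoV2_gt0 hM); exact: (block_of_blocks hM).
split; last first.
  move=> _ C K CK n c cM; have [<- <-] := ratios C K n c CK cM; split.
  - exact: (expectation_observation hM).
  - exact: (variance_observation hM).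
  - exact: (CoV2_observation hM).
split=> [bal | [C [K CK]] n c c' cM c'M share]; last first.
  have [C1 K1] := ratios C K n c CK cM; have [C2 K2] := ratios C K n c' CK c'M.
  by rewrite /share !(share_W hM)// !(share_Wn hM)// !(share_Z hM)// C1 K1 C2 K2.
(* The ratios at a reference cell [c0] serve as the constants. *)
have [c0 c0M] := cs_cells hM.
exists (fun n => umbrella_ratio M n c0), (fun n => array_ratio M n c0) => n.
split; [exact: (umbrella_ratio_gt0 hM)|exact: (array_ratio_gt0 hM)|].
move=> c cM; have [] := bal n c c0 cM c0M.
rewrite !(share_W hM)// !(share_Wn hM)// !(share_Z hM)//.
(* Equal shares of [Z] give equal values of [kappa]; this common denominator then cancels in the two
   shock shares. *)
move=> + + /invr_inj eqk; rewrite eqk.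
have k0 : (kappa (umbrella_ratio M n c0) (array_ratio M n c0))^-1 != 0.
  by rewrite invr_eq0 (kappa_ratio_neq0 hM).
move=> /(mulIf k0) eC /(mulIf k0) eK; rewrite -eC -eK.
rewrite /umbrella_ratio /array_ratio !divfK//; rewrite lt0r_neq0//.
  by apply: (source_CoV2_gt0 hM); exact: (block_of_blocks hM).
by apply: (source_CoV2_gt0 hM); exact: (block_of_blocks hM).
Qed.
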